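(* Let $m\ge 2$ and $n\ge 3$ be coprime integers. Let $a,b$ be the smallest possible positive integers such that $an-bm=1$, and let $\alpha,\beta$ be the smallest possible positive integers such that $\alpha m-\beta n=1$. Let $k\in\mathbb{N}$. If $a>\beta$, then $$\sum_{k_1+k_2=k}\frac{\tilde\beta_{k_1}(m)}{k_1!}\frac{\tilde\beta_{k_2}(n)}{k_2!}= n\sum_{k_1+k_2=k}\ \sum_{s_1+s_2=k_1}\frac{(-bm)_{s_1}}{s_1!}\frac{\tilde\sigma_{s_2}(n,a-1)}{s_2!}\frac{\tilde\beta_{k_2}(m)}{k_2!}-m\sum_{k_1+k_2=k}\ \sum_{s_1+s_2=k_1}\frac{(-bm)_{s_1}}{s_1!}\frac{\tilde\sigma_{s_2}(m,b-1)}{s_2!}\frac{\tilde\beta_{k_2}(n)}{k_2!}.$$ If $a<\beta$, then $$\sum_{k_1+k_2=k}\frac{\tilde\beta_{k_1}(m)}{k_1!}\frac{\tilde\beta_{k_2}(n)}{k_2!}= m\sum_{k_1+k_2=k}\ \sum_{s_1+s_2=k_1}\frac{(-\beta n)_{s_1}}{s_1!}\frac{\tilde\sigma_{s_2}(m,\alpha-1)}{s_2!}\frac{\tilde\beta_{k_2}(n)}{k_2!}-n\sum_{k_1+k_2=k}\ \sum_{s_1+s_2=k_1}\frac{(-\beta n)_{s_1}}{s_1!}\frac{\tilde\sigma_{s_2}(n,\beta-1)}{s_2!}\frac{\tilde\beta_{k_2}(m)}{k_2!}.$$ All sums run over pairs of nonnegative integers.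
   Context: The degenerate Bernoulli numbers $\beta_k(\lambda)$ ($\lambda\neq 0$) are defined by $\frac{t}{(1+\lambda t)^{1/\lambda}-1}=\sum_{k\ge 0}\beta_k(\lambda)\frac{t^k}{k!}$, and for a positive integer $m$ one sets $\tilde\beta_k(m)=m^k\beta_k(1/m)$; equivalently $\frac{m}{\Psi_m(x)}=\sum_{k\ge 0}\frac{(-1)^k}{k!}\tilde\beta_k(m)(1-x)^k$ with $\Psi_m(x)=\sum_{j=0}^{m-1}x^j$. For a real number $r$, $(r)_k=r(r-1)\cdots(r-k+1)$ is the falling factorial (with $(r)_0=1$). For integers $\lambda\ge 1$ and $c\ge 0$, $\tilde\sigma_k(\lambda,c)=\sum_{i=0}^{c}(\lambda i)_k$. *)

(* Defs.v *)
From mathcomp Require Import all_boot all_order all_algebra.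

Set Implicit Arguments.
Unset Strict Implicit.
Unset Printing Implicit Defensive.

Import Order.TTheory GRing.Theory Num.Theory.
Local Open Scope ring_scope.

Section PowerSeries.
Variable R : numFieldType.
Implicit Types (f g : nat -> R) (r lambda : R).

(* A formal power series is represented by its sequence of coefficients. *)
Definition fps_mul f g (k : nat) : R := \sum_(i < k.+1) f i * g (k - i)%N.

(* Coefficients 0, ..., n of 1 / f, for f 0 != 0. *)
Fixpoint fps_inv_seq f (n : nat) : seq R :=
  if n is p.+1 then
    let s := fps_inv_seq f p in
    rcons s (- (f 0%N)^-1 * \sum_(i < p.+1) f i.+1 * s`_(p - i))
  else [:: (f 0%N)^-1].

Definition fps_inv f (k : nat) : R := (fps_inv_seq f k)`_k.

Lemma size_fps_inv_seq f n : size (fps_inv_seq f n) = n.+1.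
Proof. by elim: n => //= n IHn; rewrite size_rcons IHn. Qed.

Lemma nth_fps_inv_seq f n k :
  (k <= n)%N -> (fps_inv_seq f n)`_k = fps_inv f k.
Proof.
elim: n => [|n IHn]; first by rewrite leqn0 => /eqP->.
rewrite leq_eqVlt => /orP[/eqP-> //|]; rewrite ltnS => le_kn /=.
by rewrite nth_rcons size_fps_inv_seq ltnS le_kn IHn.
Qed.

Lemma fps_mulV f k : f 0%N != 0 -> fps_mul f (fps_inv f) k = (k == 0%N)%:R.
Proof.
move=> f0; rewrite /fps_mul; case: k => [|k].
  by rewrite big_ord1 /fps_inv /= divff.
rewrite big_ord_recl /= subn0 {1}/fps_inv /= nth_rcons size_fps_inv_seq ltnn.
rewrite eqxx mulNr mulrN mulrA divff // mul1r.
rewrite [X in - X + _](eq_bigr (fun i : 'I_k.+1 =>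
  f i.+1 * fps_inv f (k - i)%N)); first last.
  by move=> i _; rewrite nth_fps_inv_seq // leq_subr.
by apply/eqP; rewrite addrC subr_eq0; apply/eqP/eq_bigr => i _; rewrite subSS.
Qed.

(* The falling factorial (r)_k. *)
Definition falling r (k : nat) : R := \prod_(i < k) (r - i%:R).

(* Newton's binomial series: the coefficient of t ^ k in (1 + lambda t) ^ r. *)
Definition binom_series lambda r (k : nat) : R :=
  falling r k / k`!%:R * lambda ^+ k.

(* The coefficient of t ^ k in (1 + lambda t) ^ (1 / lambda) - 1. *)
Definition degbern_den lambda (k : nat) : R :=
  binom_series lambda lambda^-1 k - (k == 0%N)%:R.

(* The denominator has no constant term, so t / ((1 + lambda t)^(1/lambda) - 1)
   is computed by inverting the denominator divided by t; degbern_gf and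
   degbern_uniq say that this is the sequence with the required exponential
   generating function. *)
Definition degbern lambda (k : nat) : R :=
  k`!%:R * fps_inv (fun j => degbern_den lambda j.+1) k.

Lemma degbern_den0 lambda : degbern_den lambda 0 = 0.
Proof.
by rewrite /degbern_den /binom_series /falling big_ord0 divr1 mulr1 subrr.
Qed.

Lemma degbern_den1 lambda : lambda != 0 -> degbern_den lambda 1 = 1.
Proof.
move=> l0; rewrite /degbern_den /binom_series /falling big_ord1 !subr0.
by rewrite divr1 expr1 mulVf.
Qed.

Lemma fps_mul_degbern_den (c : nat -> R) lambda k :
  fps_mul c (degbern_den lambda) k.+1
  = fps_mul c (fun j => degbern_den lambda j.+1) k.
Proof.
rewrite /fps_mul big_ord_recr /= subnn degbern_den0 mulr0 addr0.
by apply: eq_bigr => i _; rewrite subSn // -ltnS.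
Qed.

Lemma fps_mulC f g k : fps_mul f g k = fps_mul g f k.
Proof.
rewrite /fps_mul (reindex_inj rev_ord_inj) /=; apply: eq_bigr => i _.
by rewrite subSS subKn 1?mulrC // -ltnS.
Qed.

Lemma degbern_gf lambda k : lambda != 0 ->
  fps_mul (fun i => degbern lambda i / i`!%:R) (degbern_den lambda) k
  = (k == 1%N)%:R.
Proof.
move=> l0; case: k => [|k].
  by rewrite /fps_mul big_ord1 degbern_den0 mulr0.
rewrite fps_mul_degbern_den fps_mulC -(@fps_mulV (fun j => degbern_den lambda j.+1)).
  apply: eq_bigr => i _; rewrite /degbern mulrAC divff ?mul1r //.
  by rewrite pnatr_eq0 -lt0n fact_gt0.
by rewrite degbern_den1 // oner_eq0.
Qed.

Lemma degbern_uniq lambda (b : nat -> R) : lambda != 0 ->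
  (forall k, fps_mul (fun i => b i / i`!%:R) (degbern_den lambda) k
             = (k == 1%N)%:R) ->
  b =1 degbern lambda.
Proof.
move=> l0 bP; elim/ltn_ind => k IHk.
have := bP k.+1; rewrite -(degbern_gf k.+1 l0) !fps_mul_degbern_den /fps_mul.
rewrite !big_ord_recr /= subnn degbern_den1 // !mulr1.
rewrite (eq_bigr (fun i : 'I_k => degbern lambda i / i`!%:R *
  degbern_den lambda (k - i).+1)); last by move=> i _; rewrite IHk.
by move/addrI/divIf; apply; rewrite pnatr_eq0 -lt0n fact_gt0.
Qed.

Definition tbeta (m k : nat) : R := m%:R ^+ k * degbern m%:R^-1 k.

Definition tsigma (lambda c k : nat) : R :=
  \sum_(i < c.+1) falling (lambda * i)%:R k.

End PowerSeries.

(* a and b are the smallest positive integers with a n - b m = 1 (each of them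
   is minimal among all positive solutions). *)
Definition least_bezout (n m a b : nat) : Prop :=
  [/\ (0 < a)%N, (0 < b)%N, (a * n)%:Z - (b * m)%:Z = 1
    & forall a' b' : nat, (0 < a')%N -> (0 < b')%N ->
        (a' * n)%:Z - (b' * m)%:Z = 1 -> (a <= a')%N /\ (b <= b')%N].

(* Main.v *)
(* Put y for the formal variable, Q = 1 + y and Psi_l = 1 + Q + ... + Q^(l-1).
   The series of tbeta_k(l)/k! is l / Psi_l, that of (-c)_k/k! is Q^(-c), and
   that of tsigma_k(l,c)/k! is Psi_(l(c+1)) / Psi_l.  After multiplication by
   Q^(bm) Psi_m Psi_n, the first case says that
   Psi_(an) - Psi_(bm) = Q^(bm), which holds because an = bm + 1; the second is
   the first with m and n exchanged.  Power series
   are handled as polynomials modulo y^N. *)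
Require Import Defs.
From mathcomp Require Import all_boot all_order all_algebra.
From mathcomp Require Import ring.

Import Order.TTheory GRing.Theory Num.Theory.
Local Open Scope ring_scope.

Section Series.
Variable R : numFieldType.
Implicit Types (f g : nat -> R) (r : R) (p q : {poly R}).

Definition trunc (N : nat) f : {poly R} := \poly_(i < N) f i.

Definition onePX : {poly R} := 1 + 'X.

Definition geom (l : nat) : {poly R} := \sum_(i < l) onePX ^+ i.

Definition gbinom r (k : nat) : R := falling r k / k`!%:R.

Lemma fact_neq0 k : k`!%:R != 0 :> R.
Proof. by rewrite pnatr_eq0 -lt0n fact_gt0. Qed.

(** Congruence modulo ['X^N] takes the form of an explicit error term, so that congruences can be
    substituted into each other and settled by [ring]. *)
Lemma coef_eqmodXn N p q :
  (forall i, (i < N)%N -> p`_i = q`_i) -> exists s, p = q + s * 'X^N.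
Proof.
move=> pq; exists (drop_poly N (p - q)).
rewrite -[LHS](subrK q) addrC -{1}(poly_take_drop N (p - q)).
suff -> : take_poly N (p - q) = 0 by rewrite add0r.
apply/polyP => i; rewrite coef_take_poly coefB coef0.
by case: ltnP => // /pq ->; rewrite subrr.
Qed.

Lemma coef_truncM N f p k : (k < N)%N ->
  (trunc N f * p)`_k = \sum_(i < k.+1) f i * p`_(k - i).
Proof.
move=> kN; rewrite coefM; apply: eq_bigr => i _.
by rewrite coef_poly (leq_trans (ltn_ord i)).
Qed.

Lemma coef_truncM2 N f g k : (k < N)%N ->
  (trunc N f * trunc N g)`_k = \sum_(i < k.+1) f i * g (k - i)%N.
Proof.
move=> kN; rewrite coef_truncM //; apply: eq_bigr => i _.
by rewrite coef_poly (leq_ltn_trans (leq_subr _ _)).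
Qed.

Lemma coef_truncM3 N f g (h : nat -> R) k : (k < N)%N ->
  (trunc N f * trunc N g * trunc N h)`_k =
  \sum_(i < k.+1) \sum_(j < i.+1) f j * g (i - j)%N * h (k - i)%N.
Proof.
move=> kN; rewrite coefM; apply: eq_bigr => i _.
rewrite coef_truncM2; last by apply: leq_ltn_trans kN; rewrite -ltnS.
by rewrite coef_poly (leq_ltn_trans (leq_subr _ _)) // mulr_suml.
Qed.

Lemma gbinom0 r : gbinom r 0 = 1.
Proof. by rewrite /gbinom /falling big_ord0 divr1. Qed.

(** After extracting [falling r k] from both falling factorials, this is
    [r + 1 = (r - k) + (k + 1)]. *)
Lemma gbinom_pascal r k :
  gbinom (r + 1) k.+1 = gbinom r k.+1 + gbinom r k.
Proof.
have fS : falling (r + 1) k.+1 = (r + 1) * falling r k.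
  rewrite /falling big_ord_recl subr0; congr (_ * _).
  by apply: eq_bigr => i _; rewrite lift0 -natr1; ring.
have fS' : falling r k.+1 = falling r k * (r - k%:R).
  by rewrite /falling big_ord_recr.
rewrite /gbinom fS fS' factS natrM -natr1.
have k1 : k%:R + 1 != 0 :> R by rewrite natr1 pnatr_eq0.
have kf := fact_neq0 k.
by field; rewrite kf.
Qed.

Lemma trunc_gbinomS N r k : (k < N)%N ->
  (trunc N (gbinom r) * onePX)`_k = gbinom (r + 1) k.
Proof.
rewrite mulrDr mulr1 coefD coefMX; case: k => [|k] kN.
  by rewrite coef_poly kN !gbinom0 addr0.
by rewrite !coef_poly kN (ltnW kN) -gbinom_pascal.
Qed.

Lemma trunc_gbinomXn N r c k : (k < N)%N ->
  (trunc N (gbinom r) * onePX ^+ c)`_k = gbinom (r + c%:R) k.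
Proof.
elim: c k => [|c IHc] k kN; first by rewrite mulr1 coef_poly kN addr0.
(* Truncation is not multiplicative: the induction hypothesis holds only below degree [N], and its
   error stays a multiple of ['X^N] after one more factor [onePX]. *)
have [s ->] : exists s, trunc N (gbinom r) * onePX ^+ c.+1 =
    trunc N (gbinom (r + c%:R)) * onePX + s * 'X^N.
  have [s E] : exists s, trunc N (gbinom r) * onePX ^+ c =
      trunc N (gbinom (r + c%:R)) + s * 'X^N.
    by apply: coef_eqmodXn => i iN; rewrite IHc // coef_poly iN.
  by exists (s * onePX); rewrite exprSr mulrA E; ring.
by rewrite coefD coefMXn kN addr0 trunc_gbinomS // -natr1 addrA.
Qed.

Lemma gbinom_0 k : gbinom 0 k = (k == 0%N)%:R.
Proof.
case: k => [|k]; first by rewrite gbinom0.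
by rewrite /gbinom /falling big_ord_recl subrr !mul0r.
Qed.

Lemma coef_onePXn c k : (onePX ^+ c)`_k = gbinom c%:R k.
Proof.
rewrite -[c%:R]add0r -(@trunc_gbinomXn k.+1) //; congr (_`_k).
suff -> : trunc k.+1 (gbinom 0) = 1 by rewrite mul1r.
by apply/polyP => i; rewrite coef_poly gbinom_0 coef1; case: i => //= i; case: ifP.
Qed.

(** The exponents [- c] and [c] add up to 0, so the truncated series inverts [onePX ^+ c] modulo
    ['X^N]. *)
Lemma trunc_gbinomN N c :
  exists s, trunc N (gbinom (- c%:R)) * onePX ^+ c = 1 + s * 'X^N.
Proof.
apply: coef_eqmodXn => i iN.
by rewrite trunc_gbinomXn // addNr gbinom_0 coef1.
Qed.

Lemma geom_mulX l : geom l * 'X = onePX ^+ l - 1.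
Proof.
by rewrite subrX1 mulrC; congr (_ * _); rewrite /onePX addrC addrA addNr add0r.
Qed.

(** Dividing [onePX ^+ l - 1] by ['X] shifts the binomial coefficients by one index. *)
Lemma coef_geom l j : (geom l)`_j = gbinom l%:R j.+1.
Proof.
have := congr1 (fun p : {poly R} => p`_j.+1) (geom_mulX l).
by rewrite coefMX coefB coef1 subr0 coef_onePXn.
Qed.

(** The constant term of [geom l] is [l], which is nonzero in characteristic 0. *)
Lemma coprimepX_geom l : (0 < l)%N -> coprimep 'X (geom l).
Proof.
move=> l0; rewrite coprimep_sym -['X]subr0 -polyC0 coprimep_XsubC /root horner_coef0.
by rewrite coef_geom /gbinom /falling big_ord1 subr0 divr1 pnatr_eq0 -lt0n.
Qed.

Lemma coprimepX_onePX : coprimep 'X onePX.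
Proof.
by rewrite coprimep_sym -['X]subr0 -polyC0 coprimep_XsubC /root !hornerE oner_eq0.
Qed.

Lemma geom_mul l c : (\sum_(i < c) onePX ^+ (l * i)) * geom l = geom (l * c).
Proof.
apply: (mulIf (negbT (polyX_eq0 R))).
rewrite -mulrA !geom_mulX mulrC exprM [RHS]subrX1.
by congr (_ * _); apply: eq_bigr => i _; rewrite exprM.
Qed.

Lemma geomS l : geom l.+1 = geom l + onePX ^+ l.
Proof. by rewrite /geom big_ord_recr. Qed.

Lemma trunc_tsigma_geom N l c : (0 < c)%N ->
  exists s, trunc N (fun k => tsigma R l (c - 1) k / k`!%:R) * geom l =
    geom (l * c) + s * 'X^N.
Proof.
move=> c0; have [s E] : exists s,
    trunc N (fun k => tsigma R l (c - 1) k / k`!%:R) =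
    \sum_(i < c) onePX ^+ (l * i) + s * 'X^N.
  apply: coef_eqmodXn => k kN; rewrite coef_poly kN /tsigma coef_sum.
  (* The range of [tsigma] includes its upper bound, so the bound [c - 1] gives exactly [c] terms
     because [c] is positive. *)
  rewrite subn1 prednK // mulr_suml.
  by apply: eq_bigr => i _; rewrite coef_onePXn.
by exists (s * geom l); rewrite E -geom_mul; ring.
Qed.

(** In the generating function with parameter [1 / l], put [t = l * 'X]: the denominator becomes
    [onePX ^+ l - 1 = geom l * 'X], the numerator [l * 'X], and the factor ['X] cancels. *)
Lemma trunc_tbeta_geom N l : (0 < l)%N ->
  exists s, trunc N (fun k => tbeta R l k / k`!%:R) * geom l =
    l%:R%:P + s * 'X^N.
Proof.
move=> l0; have lR : l%:R != 0 :> R by rewrite pnatr_eq0 -lt0n.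
apply: coef_eqmodXn => k kN; rewrite coef_truncM // coefC.
have := @degbern_gf R l%:R^-1 k.+1 (invr_neq0 lR).
rewrite fps_mul_degbern_den /fps_mul => E.
(* The power [l ^ (k + 1)] carries out the substitution [t = l * 'X] in degree [k + 1]; it splits as
   [l ^ i], absorbed by [tbeta], times [l ^ (k - i + 1)], which cancels the scaling in
   [degbern_den]. *)
transitivity (l%:R ^+ k.+1 * ((k.+1 == 1%N)%:R : R)); last first.
  by case: k {E kN} => [|k]; rewrite ?mulr1 ?mulr0.
rewrite -E mulr_sumr; apply: eq_bigr => i _.
rewrite coef_geom /tbeta /degbern_den /binom_series subr0 invrK -/(gbinom _ _).
have -> : l%:R ^+ k.+1 = l%:R ^+ i * l%:R ^+ (k - i).+1 :> R.
  by rewrite -exprD addnS subnKC // -ltnS.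
rewrite exprVn.
have fi := fact_neq0 i.
by field; rewrite expf_neq0.
Qed.

Theorem tbeta_convolution (m n a b k : nat) :
  (0 < m)%N -> (0 < n)%N -> (0 < a)%N -> (0 < b)%N -> (a * n = (b * m).+1)%N ->
     \sum_(k1 < k.+1)
        (tbeta R m k1 / k1`!%:R) * (tbeta R n (k - k1) / (k - k1)`!%:R)
     = n%:R * (\sum_(k1 < k.+1) \sum_(s1 < k1.+1)
          (falling (- (b * m)%:R) s1 / s1`!%:R)
          * (tsigma R n (a - 1) (k1 - s1) / (k1 - s1)`!%:R)
          * (tbeta R m (k - k1) / (k - k1)`!%:R))
     - m%:R * (\sum_(k1 < k.+1) \sum_(s1 < k1.+1)
          (falling (- (b * m)%:R) s1 / s1`!%:R)
          * (tsigma R m (b - 1) (k1 - s1) / (k1 - s1)`!%:R)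
          * (tbeta R n (k - k1) / (k - k1)`!%:R)).
Proof.
move=> m0 n0 a0 b0 anbm; set N := k.+1.
have [rm Bm] := trunc_tbeta_geom N m m0.
have [rn Bn] := trunc_tbeta_geom N n n0.
have [sn Sn] := trunc_tsigma_geom N n a a0.
have [sm Sm] := trunc_tsigma_geom N m b b0.
have [t F] := trunc_gbinomN N (b * m).
(* The relation between [a] and [b] enters here: [geom (a * n)] splits as [geom (b * m)] plus
   [onePX ^+ (b * m)]. *)
rewrite mulnC anbm geomS in Sn; rewrite mulnC in Sm.
have kN : (k < N)%N by [].
rewrite -(coef_truncM2 N (fun k => tbeta R m k / k`!%:R)
  (fun k => tbeta R n k / k`!%:R)) //.
rewrite -(coef_truncM3 N (gbinom (- (b * m)%:R))
  (fun k => tsigma R n (a - 1) k / k`!%:R)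
  (fun k => tbeta R m k / k`!%:R)) //.
rewrite -(coef_truncM3 N (gbinom (- (b * m)%:R))
  (fun k => tsigma R m (b - 1) k / k`!%:R)
  (fun k => tbeta R n k / k`!%:R)) //.
set A := trunc N _ in Bm *; set B := trunc N _ in Bn *.
set Fp := trunc N _ in F *.
set C := trunc N _ in Sn *; set D := trunc N _ in Sm *.
rewrite -!coefCM -coefB; apply/eqP; rewrite -subr_eq0 -coefB; apply/eqP.
set Q := onePX ^+ (b * m) in Sn F *; set G := geom (b * m) in Sn Sm *.
set M := m%:R%:P in Bm *; set L := n%:R%:P in Bn *.
pose E : {poly R} := A * B - (L * (Fp * C * A) - M * (Fp * D * B)).
rewrite -/E.
(* As [N = k + 1], a multiple of ['X^N] has no coefficient of degree [k]. *)
suff /dvdpP[q ->] : 'X^N %| E by rewrite coefMXn kN.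
(* Denominators may be cleared without affecting divisibility by ['X^N], since their product has
   nonzero constant term. *)
have cop : coprimep 'X^N (Q * (geom m * geom n)).
  rewrite coprimep_expl // !coprimepMr !coprimepX_geom // andbT.
  by rewrite coprimep_expr // coprimepX_onePX.
rewrite -(Gauss_dvdpr _ cop).
have -> : Q * (geom m * geom n) * E =
    Q * (A * geom m) * (B * geom n)
    - (L * (Fp * Q) * (C * geom n) * (A * geom m)
       - M * (Fp * Q) * (D * geom m) * (B * geom n)).
  by rewrite /E; ring.
rewrite Bm Bn Sn Sm F; set x := 'X^N.
(* The terms free of [x] cancel: [Q * M * L - (L * (G + Q) * M - M * G * L) = 0]. The witness
   collects the remaining terms, divided by [x]. *)
apply/dvdpP; exists (Q * (M * rn + rm * L + rm * rn * x)
  - L * (t * (G + Q + sn * x) * (M + rm * x) + sn * (M + rm * x) + (G + Q) * rm)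
  + M * (t * (G + sm * x) * (L + rn * x) + sm * (L + rn * x) + G * rn)).
by ring.
Qed.

End Series.

Lemma least_bezout_eq n m a b :
  least_bezout n m a b -> [/\ (0 < a)%N, (0 < b)%N & (a * n = (b * m).+1)%N].
Proof.
case=> a0 b0 /eqP; rewrite subr_eq addrC -[1]/(1%:Z) -PoszD addn1.
by move=> /eqP[] E _.
Qed.

Theorem theorem7p3 (R : numFieldType) (m n a b alpha beta k : nat)
    (hm : (2 <= m)%N) (hn : (3 <= n)%N) (hmn : coprime m n)
    (hab : least_bezout n m a b) (halphabeta : least_bezout m n alpha beta) :
  ((beta < a)%N ->
     \sum_(k1 < k.+1)
        (tbeta R m k1 / k1`!%:R) * (tbeta R n (k - k1) / (k - k1)`!%:R)
     = n%:R * (\sum_(k1 < k.+1) \sum_(s1 < k1.+1)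
          (falling (- (b * m)%:R) s1 / s1`!%:R)
          * (tsigma R n (a - 1) (k1 - s1) / (k1 - s1)`!%:R)
          * (tbeta R m (k - k1) / (k - k1)`!%:R))
     - m%:R * (\sum_(k1 < k.+1) \sum_(s1 < k1.+1)
          (falling (- (b * m)%:R) s1 / s1`!%:R)
          * (tsigma R m (b - 1) (k1 - s1) / (k1 - s1)`!%:R)
          * (tbeta R n (k - k1) / (k - k1)`!%:R)))
  /\
  ((a < beta)%N ->
     \sum_(k1 < k.+1)
        (tbeta R m k1 / k1`!%:R) * (tbeta R n (k - k1) / (k - k1)`!%:R)
     = m%:R * (\sum_(k1 < k.+1) \sum_(s1 < k1.+1)
          (falling (- (beta * n)%:R) s1 / s1`!%:R)
          * (tsigma R m (alpha - 1) (k1 - s1) / (k1 - s1)`!%:R)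
          * (tbeta R n (k - k1) / (k - k1)`!%:R))
     - n%:R * (\sum_(k1 < k.+1) \sum_(s1 < k1.+1)
          (falling (- (beta * n)%:R) s1 / s1`!%:R)
          * (tsigma R n (beta - 1) (k1 - s1) / (k1 - s1)`!%:R)
          * (tbeta R m (k - k1) / (k - k1)`!%:R))).
Proof.
have [m0 n0] : (0 < m)%N /\ (0 < n)%N by rewrite !(leq_trans _ hm, leq_trans _ hn).
have [a0 b0 E] := least_bezout_eq _ _ _ _ hab.
have [al0 be0 E'] := least_bezout_eq _ _ _ _ halphabeta.
split=> _; first exact: tbeta_convolution.
rewrite -(@tbeta_convolution R n m alpha beta k n0 m0 al0 be0 E').
(* Exchanging [m] and [n] swaps the two factors of the left-hand convolution; reversing the
   summation index restores their order. *)
rewrite (reindex_inj rev_ord_inj); apply: eq_bigr => i _ /=.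
by rewrite subSS subKn 1?mulrC // -ltnS.
Qed.
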